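(* Let $n\ge 1$ and $k\ge 0$ be integers. If $f\colon S^{2n-1}\to \mathbb{R}^{2kn+2n-1}$ is odd and continuous, then there is a subset $X\subseteq S^{2n-1}$ of diameter at most $\frac{2\pi k}{2k+1}$ such that $\mathrm{conv}(f(X))$ contains the origin.
   Context: The sphere $S^{2n-1}$ carries the standard spherical geodesic metric in which every great circle has length $2\pi$, and $\mathrm{diam}(X)=\sup\{d(x,y) : x,y\in X\}$ is taken with respect to it. A map $f\colon S^m\to\mathbb{R}^l$ is odd if $f(-x)=-f(x)$ for all $x\in S^m$. $\mathrm{conv}(Y)$ denotes the convex hull of $Y$, i.e. the set of finite convex combinations of points of $Y$. *)

(* Defs.v *)
From HB Require Import structures.
From mathcomp Require Import all_boot all_order all_algebra.
From mathcomp Require Import all_classical all_reals all_analysis.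

Set Implicit Arguments.
Unset Strict Implicit.
Unset Printing Implicit Defensive.

Import Order.TTheory GRing.Theory Num.Theory.
Import numFieldNormedType.Exports.

Local Open Scope classical_set_scope.
Local Open Scope ring_scope.

Definition dot {R : realType} {d : nat} (x y : 'rV[R]_d) : R :=
  \sum_(i < d) x 0 i * y 0 i.

(* [unit_sphere R d] is S^(d-1): the index is the dimension of the ambient
   space.  The library norm on row vectors is the sup norm, so the Euclidean
   norm is expressed through [dot]. *)
Definition unit_sphere (R : realType) (d : nat) : set 'rV[R]_d :=
  [set x | dot x x = 1].
Arguments unit_sphere : clear implicits.

(* The angle between unit vectors, i.e. the length of a shortest great-circle
   arc joining them; only meaningful on the unit sphere. *)
Definition sphere_dist {R : realType} {d : nat} (x y : 'rV[R]_d) : R :=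
  acos (dot x y).

(* Taken in the extended reals so that the supremum always exists; the
   diameter of the empty set is -oo. *)
Definition sphere_diam {R : realType} {d : nat} (X : set 'rV[R]_d) : \bar R :=
  ereal_sup [set (sphere_dist p.1 p.2)%:E | p in X `*` X].

Definition odd_on_sphere {R : realType} {d l : nat}
    (f : 'rV[R]_d -> 'rV[R]_l) : Prop :=
  forall x, unit_sphere R d x -> f (- x) = - f x.

Definition conv_hull {R : realType} {l : nat} (Y : set 'rV[R]_l) :
    set 'rV[R]_l :=
  [set z | exists m (a : 'I_m -> R) (y : 'I_m -> 'rV[R]_l),
    [/\ forall i, 0 <= a i, \sum_(i < m) a i = 1,
        forall i, Y (y i) & z = \sum_(i < m) a i *: y i]].

(* Main.v *)
Require Import Defs.
From HB Require Import structures.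
From mathcomp Require Import all_boot all_order all_algebra.
From mathcomp Require Import all_classical all_reals all_analysis.
From mathcomp Require Import zify ring lra.

(* Let V be the space of functions P(x) = sum of c_ij x_i^(2j+1), i < 2n, j <= k,
   on the sphere; its dimension exceeds that of the target of f by one.  For P in
   V let X_P be the set of maximizers of P.

   Some P <> 0 in V has 0 in conv f(X_P).  Indeed, for a finite set Y of points
   and eps > 0 the map P |-> sum_y w_y(P) f(y), y in Y and -Y, where
   w_y(P) = max(0, P(y) - max_Y |P| + eps), is odd and continuous, so it takes
   arbitrarily small values by the Borsuk-Ulam theorem; Caratheodory's theorem
   bounds the number of points y involved, and one passes to the limit as
   eps -> 0 and Y grows.

   X_P has diameter at most pi - pi/(2k+1).  If P is maximal at x and at y, it is
   minimal at -y, and on the great circle through x and -y it is a trigonometric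
   polynomial of degree at most 2k+1; by a theorem of M. Riesz its maxima and
   minima are at distance at least pi/(2k+1).

   The Borsuk-Ulam theorem itself follows from Fan's count of the simplices with
   alternating labels in a fine symmetric triangulation of the cross-polytope,
   carried out with singular-type chains mod 2, which need not be embedded. *)

Set Implicit Arguments.
Unset Strict Implicit.
Unset Printing Implicit Defensive.

Import Order.TTheory GRing.Theory Num.Theory.
Import numFieldNormedType.Exports.

Local Open Scope classical_set_scope.
Local Open Scope ring_scope.

(** * Mod-2 cochains *)

(** A list of vertices stands for an ordered, possibly degenerate simplex, and a cochain mod 2 is a
    boolean function of it. The recursion adds up [phi] over the faces obtained by deleting one
    entry. *)
Fixpoint cobound (T : Type) (phi : seq T -> bool) (s : seq T) : bool :=
  if s is x :: s' then phi s' (+) cobound (fun t => phi (x :: t)) s' else false.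

(** The prism operator of singular homology: the sum of [phi] over the simplices f x_0, ..., f x_j,
    g x_j, ..., g x_r. *)
Fixpoint prism (T : Type) (f g : T -> T) (phi : seq T -> bool) (s : seq T) : bool :=
  if s is x :: s' then
    phi [:: f x, g x & map g s'] (+) prism f g (fun t => phi (f x :: t)) s'
  else false.

Lemma eq_cobound (T : eqType) (phi psi : seq T -> bool) (s : seq T) :
  (forall t, subseq t s -> phi t = psi t) -> cobound phi s = cobound psi s.
Proof.
elim: s phi psi => //= x s IH phi psi eq_phi; congr (_ (+) _).
  by apply: eq_phi; exact: subseq_cons.
by apply: IH => t ts; apply: eq_phi; rewrite /= eqxx.
Qed.

Lemma cobound_map (T U : Type) (f : T -> U) (phi : seq U -> bool) (s : seq T) :
  cobound (fun t => phi (map f t)) s = cobound phi (map f s).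
Proof. by elim: s phi => //= x s IH phi; rewrite (IH (fun t => phi (f x :: t))). Qed.

Lemma coboundD (T : Type) (phi psi : seq T -> bool) (s : seq T) :
  cobound (fun t => phi t (+) psi t) s = cobound phi s (+) cobound psi s.
Proof. by elim: s phi psi => //= x s IH phi psi; rewrite IH addbACA. Qed.

Lemma prismD (T : Type) (f g : T -> T) (phi psi : seq T -> bool) (s : seq T) :
  prism f g (fun t => phi t (+) psi t) s = prism f g phi s (+) prism f g psi s.
Proof. by elim: s phi psi => //= x s IH phi psi; rewrite IH addbACA. Qed.

(** The homotopy formula, without signs: faces shared by consecutive simplices of the prism cancel,
    the side faces are the prism over the boundary, and the bottom and the top remain. *)
Lemma prism_cobound (T : Type) (f g : T -> T) (phi : seq T -> bool) (s : seq T) :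
  prism f g (cobound phi) s (+) cobound (prism f g phi) s =
  phi (map f s) (+) phi (map g s).
Proof.
elim: s phi => [|x s IH] phi /=; first by rewrite addbb.
have := IH (fun t => phi (f x :: t)).
rewrite !prismD !coboundD (cobound_map g (fun t => phi [:: f x, g x & t])).
case: (prism _ _ _ s); case: (cobound _ s); case: (cobound _ (map g s));
case: (prism f g phi s); case: (cobound _ s); case: (phi _);
case: (phi _); case: (phi _) => //=.
Qed.

Lemma eq_prism (T : eqType) (f g : T -> T) (phi psi : seq T -> bool) (s : seq T) :
  (forall t, size t = (size s).+1 -> {subset t <= map f s ++ map g s} ->
    phi t = psi t) ->
  prism f g phi s = prism f g psi s.
Proof.
elim: s phi psi => //= x s IH phi psi eq_phi; congr (_ (+) _).
  apply: eq_phi => [|y]; first by rewrite /= size_map.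
  rewrite !(inE, mem_cat).
  by do ![case/orP => [->|]; rewrite ?orbT //]; move=> ->; rewrite !orbT.
apply: IH => t st sub; apply: eq_phi => [|y]; first by rewrite /= st.
rewrite inE => /orP[/eqP->|/sub]; first by rewrite mem_head.
by rewrite !(inE, mem_cat) => /orP[]->; rewrite ?orbT.
Qed.

(** * Alternating labels and Fan's local count *)

Fixpoint alternates (b : bool) (s : seq bool) : bool :=
  if s is x :: s' then (x == b) && alternates (~~ b) s' else true.

Lemma cobound_and (T : Type) (a : bool) (phi : seq T -> bool) (s : seq T) :
  cobound (fun t => a && phi t) s = a && cobound phi s.
Proof. by elim: s phi => /= [|x s IH] phi; rewrite ?andbF // IH andb_addr. Qed.

(** If [s] alternates from [b], only deleting its last entry leaves a list alternating from [b]; if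
    it alternates from [~~ b], only deleting the first does. Otherwise a good deletion must remove
    one of two equal neighbours, and removing the other gives the same list, so these cancel. *)
Lemma cobound_alternates (b : bool) (s : seq bool) : s != [::] ->
  cobound (alternates b) s = alternates b s (+) alternates (~~ b) s.
Proof.
elim: s b => //= x s IH b _; rewrite cobound_and.
case: s IH => [|y s] IH; first by case: x; case: b.
by rewrite IH // negbK; case: x b => [] []; case: (alternates _ _); case: (alternates _ _).
Qed.

Lemma cobound_perm (T : eqType) (phi : seq T -> bool) (s : seq T) :
  (forall t u : seq T, {subset t <= s} -> perm_eq t u -> phi t = phi u) ->
  cobound phi s = \big[addb/false]_(x <- s) phi (rem x s).
Proof.
elim: s phi => [|x s IH] phi phiP /=; first by rewrite big_nil.
rewrite big_cons /= eqxx; congr (_ (+) _); rewrite IH; last first.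
  move=> t u ts tu; apply: phiP; last by rewrite perm_cons.
  by move=> y; rewrite !inE => /orP[->//|/ts->]; rewrite orbT.
apply: eq_big_seq => y ys /=. case: (x =P y) => [->|//].
apply: phiP; last by rewrite perm_sym perm_to_rem.
move=> z; rewrite inE => /orP[/eqP->|/mem_rem zs]; first by rewrite inE ys orbT.
by rewrite inE zs orbT.
Qed.

(** The pair (j, b) encodes the signed label j+1 or -(j+1), with [b] true for the positive sign. *)
Definition neg_label (a : nat * bool) : nat * bool := (a.1, ~~ a.2).

Definition label_le (a b : nat * bool) : bool := (a.1 <= b.1)%N.

Definition fan (s : seq (nat * bool)) : bool :=
  alternates true (map snd (sort label_le s)).

Lemma label_le_total : total label_le.
Proof. by move=> a b; exact: leq_total. Qed.

Lemma label_le_trans : transitive label_le.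
Proof. by move=> a b c; exact: leq_trans. Qed.

Lemma alternates_neg (b : bool) (s : seq (nat * bool)) :
  alternates b (map snd (map neg_label s)) = alternates (~~ b) (map snd s).
Proof. by elim: s b => //= a s IH b; rewrite IH; case: a.2 b => [] []. Qed.

Lemma fan_neg (s : seq (nat * bool)) :
  fan (map neg_label s) = alternates false (map snd (sort label_le s)).
Proof. by rewrite /fan sort_map alternates_neg. Qed.

(** Without complementary labels, ties in the sorting order are equal labels, so [fan] ignores the
    order of its argument. One may thus sort [s] first; deletions keep it sorted, and
    [cobound_alternates] applies to the signs. *)
Lemma cobound_fan (s : seq (nat * bool)) : s != [::] ->
  {in s &, forall a b, a.1 = b.1 -> a.2 = b.2} ->
  cobound fan s = fan s (+) fan (map neg_label s).
Proof.
move=> s0 no_compl; rewrite fan_neg.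
have fan_perm (t u : seq _) : {subset t <= s} -> perm_eq t u -> fan t = fan u.
  move=> ts tu; rewrite /fan; congr (alternates _ (map _ _)).
  apply/perm_sort_inP => //.
  - by move=> a b _ _; exact: label_le_total.
  - by move=> a b c _ _ _; exact: label_le_trans.
  - move=> a b /ts sa /ts sb; rewrite /label_le => /anti_leq ab.
    by rewrite (surjective_pairing a) (surjective_pairing b) ab (no_compl a b).
rewrite cobound_perm //.
have ss : perm_eq s (sort label_le s) by rewrite perm_sym perm_sort.
rewrite (perm_big _ ss) /=.
transitivity (cobound fan (sort label_le s)).
  rewrite cobound_perm => [|t u ts]; last first.
    by apply: fan_perm => y /ts; rewrite mem_sort.
  apply: eq_big_seq => a; rewrite mem_sort => sa.
  apply: fan_perm => [y /mem_rem //|].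
  by rewrite -(perm_cons a) -(permPl (perm_to_rem sa)) -(permPr (perm_to_rem _)) ?mem_sort.
rewrite /fan -(cobound_alternates true); last by rewrite -size_eq0 size_map size_sort size_eq0.
rewrite -(cobound_map snd); apply: eq_cobound => t ts.
rewrite (sorted_sort label_le_trans) //.
by apply: (subseq_sorted label_le_trans ts); exact: sort_sorted label_le_total _.
Qed.

Lemma alternates_sorted (b : bool) (s : seq (nat * bool)) :
  {in s &, forall a b, a.1 = b.1 -> a.2 = b.2} ->
  sorted label_le s -> alternates b (map snd s) -> sorted ltn (map fst s).
Proof.
case: s => //= a s; elim: s a b => //= a' s IH a b no_compl /andP[aa' s_sorted].
move=> /and3P[/eqP ab /eqP a'b alt]; rewrite (IH a' (~~ b)) //.
- rewrite andbT ltn_neqAle -/(label_le a a') aa' andbT; apply/eqP => e.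
  have := no_compl a a'; rewrite !inE !eqxx orbT => /(_ isT isT e).
  by rewrite ab a'b; case: b {alt ab a'b}.
- by move=> x y xs ys; apply: no_compl; rewrite inE ?xs ?ys orbT.
- by rewrite a'b eqxx.
Qed.

(** Equal indices carry equal signs, so alternation forces strictly increasing indices, and there
    are only [N] of them. *)
Lemma fan_few_labels (N : nat) (s : seq (nat * bool)) :
  {in s &, forall a b, a.1 = b.1 -> a.2 = b.2} ->
  {in s, forall a, (a.1 < N)%N} -> (N < size s)%N -> fan s = false.
Proof.
move=> no_compl sN; apply: contraTF => alt.
have ls : sorted ltn (map fst (sort label_le s)).
  apply: alternates_sorted alt; last exact: sort_sorted label_le_total _.
  by move=> a b; rewrite !mem_sort; exact: no_compl.
have := uniq_leq_size (sorted_uniq ltn_trans ltnn ls) (s2 := iota 0 N).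
rewrite size_map size_sort size_iota -leqNgt; apply => i /mapP[a].
by rewrite mem_sort mem_iota => /sN aN ->.
Qed.

(** * Iterated suspensions of the cross-polytope and Tucker's lemma *)

Section Hemispheres.

Variables (R : realFieldType) (N m : nat).

Local Notation V := 'rV[R]_N.+1.

Definition norm1 (x : V) : R := \sum_e `|x 0 e|.

Definition pole (i : nat) : V := delta_mx 0 (inord i).

Definition toward_pole (i s : nat) (x : V) : V :=
  (1 - s%:R / m%:R) *: x + (s%:R / m%:R) *: pole i.

(* Mod-2 chains are represented by their pairing with cochains.  The chain
   [hemisphere i] is the upper half of the subdivided i-dimensional
   cross-polytope boundary: the homotopy contracting the equator, i.e. the
   previous hemisphere and its antipode, to the pole. *)
Fixpoint hemisphere (i : nat) (phi : seq V -> bool) : bool :=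
  if i is i'.+1 then
    \big[addb/false]_(0 <= s < m)
      let psi := prism (toward_pole i s) (toward_pole i s.+1) phi in
      hemisphere i' psi (+) hemisphere i' (fun t => psi (map -%R t))
  else phi [:: pole 0].

Definition sphere_chain (i : nat) (phi : seq V -> bool) : bool :=
  hemisphere i phi (+) hemisphere i (fun t => phi (map -%R t)).

Definition in_equator (i : nat) (x : V) : Prop :=
  norm1 x = 1 /\ forall e : 'I_N.+1, (i < e)%N -> x 0 e = 0.

(** The mesh bound grows with [i] because each suspension adds 2/m to it. *)
Definition fine_simplex (i : nat) (s : seq V) : Prop :=
  [/\ size s = i.+1, {in s, forall x, in_equator i x} &
    {in s &, forall x y, norm1 (x - y) <= (2 * i)%:R / m%:R}].

Lemma norm1N (x : V) : norm1 (- x) = norm1 x.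
Proof. by apply: eq_bigr => e _; rewrite mxE normrN. Qed.

Lemma norm1Z (a : R) (x : V) : norm1 (a *: x) = `|a| * norm1 x.
Proof. by rewrite /norm1 mulr_sumr; apply: eq_bigr => e _; rewrite mxE normrM. Qed.

Lemma norm1D (x y : V) : norm1 (x + y) <= norm1 x + norm1 y.
Proof. by rewrite /norm1 -big_split; apply: ler_sum => e _; rewrite mxE ler_normD. Qed.

Lemma norm1_pole (i : nat) : norm1 (pole i) = 1.
Proof.
rewrite /norm1 (bigD1 (inord i)) //= mxE !eqxx normr1 big1 ?addr0 // => e ei.
by rewrite mxE (negPf ei) andbF normr0.
Qed.

Lemma fine_simplexN (i : nat) (s : seq V) :
  fine_simplex i s -> fine_simplex i (map -%R s).
Proof.
case=> sz eq_s close; split; first by rewrite size_map.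
  move=> _ /mapP[x xs ->]; have [x1 x0] := eq_s x xs; split; first by rewrite norm1N.
  by move=> e ie; rewrite mxE x0 // oppr0.
move=> _ _ /mapP[x xs ->] /mapP[y ys ->].
by rewrite -opprD norm1N; exact: close.
Qed.

Lemma norm1_disjoint (a b : R) (i : nat) (x : V) : (i < N)%N ->
  in_equator i x -> norm1 (a *: x + b *: pole i.+1) = `|a| + `|b|.
Proof.
move=> iN [x1 x0]; have iE : (inord i.+1 : 'I_N.+1) = i.+1 :> nat by rewrite inordK.
rewrite -[`|a|]mulr1 -x1 /norm1 (bigD1 (inord i.+1)) //= !mxE x0 ?iE //.
rewrite !eqxx mulr0 mulr1 add0r addrC; congr (_ + _).
rewrite [in RHS](bigD1 (inord i.+1)) //= x0 ?iE // normr0 add0r mulr_sumr.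
apply: eq_bigr => e ei; rewrite !mxE (negPf ei) andbF mulr0 addr0.
by rewrite normrM.
Qed.

Hypothesis m_gt0 : (0 < m)%N.

Let ratio (a : nat) : R := a%:R / m%:R.

Let ratio_ge0 (a : nat) : 0 <= ratio a.
Proof. by rewrite divr_ge0 ?ler0n. Qed.

Let ratio_le1 (a : nat) : (a <= m)%N -> 0 <= 1 - ratio a.
Proof. by move=> am; rewrite subr_ge0 ler_pdivrMr ?ltr0n // mul1r ler_nat. Qed.

Lemma toward_pole_equator (i a : nat) (x : V) : (i < N)%N -> (a <= m)%N ->
  in_equator i x -> in_equator i.+1 (toward_pole i.+1 a x).
Proof.
move=> iN am xi; split.
  rewrite (norm1_disjoint _ _ iN xi) !ger0_norm ?ratio_ge0 ?ratio_le1 //.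
  by rewrite subrK.
move=> e ie; rewrite !mxE xi.2 ?(ltnW ie) // mulr0 add0r.
suff -> : (e == inord i.+1) = false by rewrite andbF mulr0.
by apply/negP => /eqP ee; move: ie; rewrite ee inordK // ltnn.
Qed.

(** The difference is the old one, scaled by 1 - b/m, plus a multiple of at most 1/m of
    [x - pole i.+1], whose norm is at most 2. *)
Lemma toward_pole_close (i a b : nat) (x y : V) : (i < N)%N ->
  (b <= m)%N -> (a <= b.+1)%N -> (b <= a.+1)%N ->
  in_equator i x -> norm1 (x - y) <= (2 * i)%:R / m%:R ->
  norm1 (toward_pole i.+1 a x - toward_pole i.+1 b y) <= (2 * i.+1)%:R / m%:R.
Proof.
move=> iN bm ab ba [x1 _] xy.
have -> : toward_pole i.+1 a x - toward_pole i.+1 b y =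
    (1 - ratio b) *: (x - y) + (ratio b - ratio a) *: (x - pole i.+1).
  by apply/rowP => e; rewrite !mxE /ratio; ring.
apply: le_trans (norm1D _ _) _; rewrite !norm1Z.
have b1 : `|1 - ratio b| <= 1.
  by rewrite ger0_norm ?ratio_le1 // gerBl ratio_ge0.
have ab1 : `|ratio b - ratio a| <= m%:R^-1.
  rewrite -mulrBl normrM [X in _ * X]gtr0_norm ?invr_gt0 ?ltr0n //.
  rewrite ler_piMl ?invr_ge0 ?ler0n // ler_norml.
  have ab' : a%:R <= b%:R + 1 :> R by rewrite natr1 ler_nat.
  have ba' : b%:R <= a%:R + 1 :> R by rewrite natr1 ler_nat.
  by apply/andP; split; lra.
have xe : norm1 (x - pole i.+1) <= 2.
  by apply: le_trans (norm1D _ _) _; rewrite norm1N x1 norm1_pole.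
have n0 (z : V) : 0 <= norm1 z by apply: sumr_ge0.
rewrite mulnS natrD addrC mulrDl lerD //.
  by rewrite mulrC ler_pM ?normr_ge0.
by apply: le_trans xy; rewrite ler_piMl.
Qed.

Lemma fine_simplex_prism (i a : nat) (s t : seq V) : (i < N)%N -> (a < m)%N ->
  fine_simplex i s -> size t = (size s).+1 ->
  {subset t <= map (toward_pole i.+1 a) s ++ map (toward_pole i.+1 a.+1) s} ->
  fine_simplex i.+1 t.
Proof.
move=> iN am [sz eq_s close] tsz sub.
have tP x : x \in t -> exists b y,
    [/\ b = a \/ b = a.+1, (b <= m)%N, y \in s & x = toward_pole i.+1 b y].
  move=> /sub; rewrite mem_cat => /orP[] /mapP[y ys ->].
    by exists a, y; split; [left | exact: ltnW | |].
  by exists a.+1, y; split; [right | | |].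
split; first by rewrite tsz sz.
  move=> x /tP[b [y [_ bm ys ->]]]; apply: toward_pole_equator => //.
  exact: eq_s.
move=> _ _ /tP[b [x [ba bm xs ->]]] /tP[c [y [ca cm ys ->]]].
apply: toward_pole_close => //.
- by case: ba ca => [->|->] [->|->]; lia.
- by case: ba ca => [->|->] [->|->]; lia.
- exact: eq_s.
- exact: close.
Qed.

(** As chains are known only through their values on cochains, this is how the shape of their
    simplices is used: only values on fine simplices matter. *)
Lemma eq_hemisphere (i : nat) (phi psi : seq V -> bool) : (i <= N)%N ->
  (forall s, fine_simplex i s -> phi s = psi s) ->
  hemisphere i phi = hemisphere i psi.
Proof.
elim: i phi psi => [|i IH] phi psi iN eq_phi /=.
  apply: eq_phi; split => // [x|x y]; rewrite !inE => /eqP->.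
    split=> [|e e0]; first exact: norm1_pole.
    rewrite mxE andbC; case: eqP => //= ee.
    by move: e0; rewrite ee inordK.
  by move=> /eqP->; rewrite subrr muln0 mul0r /norm1 big1 // => e; rewrite mxE normr0.
rewrite big_nat_cond [RHS]big_nat_cond; apply: eq_bigr => a /andP[/andP[_ am] _].
have eq_pr s : fine_simplex i s ->
    prism (toward_pole i.+1 a) (toward_pole i.+1 a.+1) phi s =
    prism (toward_pole i.+1 a) (toward_pole i.+1 a.+1) psi s.
  move=> fs; apply: eq_prism => t tsz sub; apply: eq_phi.
  exact: fine_simplex_prism fs tsz sub.
congr (_ (+) _); apply: IH (ltnW iN) _ => s fs; apply: eq_pr => //.
exact: fine_simplexN.
Qed.

Lemma eq_sphere_chain (i : nat) (phi psi : seq V -> bool) : (i <= N)%N ->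
  (forall s, fine_simplex i s -> phi s = psi s) ->
  sphere_chain i phi = sphere_chain i psi.
Proof.
move=> iN eq_phi; congr (_ (+) _); apply: eq_hemisphere => // s fs; apply: eq_phi => //.
exact: fine_simplexN.
Qed.

Lemma hemisphereD (i : nat) (phi psi : seq V -> bool) : (i <= N)%N ->
  hemisphere i (fun s => phi s (+) psi s) = hemisphere i phi (+) hemisphere i psi.
Proof.
elim: i phi psi => //= i IH phi psi iN; rewrite -big_split /=; apply: eq_bigr => a _.
rewrite addbACA; congr (_ (+) _); rewrite -IH ?(ltnW iN) //;
  by apply: eq_hemisphere (ltnW iN) _ => s _; rewrite prismD.
Qed.

Lemma sphere_chainD (i : nat) (phi psi : seq V -> bool) : (i <= N)%N ->
  sphere_chain i (fun s => phi s (+) psi s) =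
  sphere_chain i phi (+) sphere_chain i psi.
Proof. by move=> iN; rewrite /sphere_chain !hemisphereD // addbACA. Qed.

Lemma sphere_chainN (i : nat) (phi : seq V -> bool) : (i <= N)%N ->
  sphere_chain i (fun s => phi (map -%R s)) = sphere_chain i phi.
Proof.
move=> iN; rewrite [RHS]addbC; congr (_ (+) _); apply: eq_hemisphere => // s _.
by rewrite mapK //; exact: opprK.
Qed.

(** The boundary of a hemisphere is its equator. The homotopy formula, with the boundary term killed
    by [cycle], makes the sum over the layers telescope to [F 0], the equator itself, and [F m], its
    image at the pole. There all simplices are constant, so the two halves of the equator cancel. *)
Lemma hemisphere_cobound_step (i : nat) (phi : seq V -> bool) : (i < N)%N ->
  (forall psi, sphere_chain i (cobound psi) = false) ->
  hemisphere i.+1 (cobound phi) = sphere_chain i phi.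
Proof.
move=> iN cycle; set T := toward_pole i.+1.
pose F a := sphere_chain i (fun s => phi (map (T a) s)).
have -> : hemisphere i.+1 (cobound phi) = \big[addb/false]_(0 <= a < m) (F a (+) F a.+1).
  apply: eq_bigr => a _.
  transitivity (sphere_chain i (prism (T a) (T a.+1) (cobound phi)) (+)
                sphere_chain i (cobound (prism (T a) (T a.+1) phi))).
    by rewrite cycle addbF.
  rewrite -[LHS]sphere_chainD ?(ltnW iN) // -[RHS]sphere_chainD ?(ltnW iN) //.
  apply: eq_sphere_chain (ltnW iN) _ => s _.
  exact: prism_cobound.
have -> : \big[addb/false]_(0 <= a < m) (F a (+) F a.+1) = F 0 (+) F m.
  by elim: (m) => [|k IHk]; rewrite ?big_nil ?addbb // big_nat_recr //= IHk addbA addbK.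
have -> : F 0%N = sphere_chain i phi.
  apply: eq_sphere_chain (ltnW iN) _ => s _; congr phi; rewrite -[RHS]map_id.
  by apply: eq_map => x; rewrite /T /toward_pole mul0r subr0 scale1r scale0r addr0.
suff -> : F m = false by rewrite addbF.
have Tm x : T m x = pole i.+1.
  by rewrite /T /toward_pole divff ?pnatr_eq0 -?lt0n // subrr scale0r add0r scale1r.
have TmE s : map (T m) s = nseq (size s) (pole i.+1).
  by elim: s => //= x s ->; rewrite Tm.
rewrite /F /sphere_chain (eq_hemisphere (ltnW iN) (psi := fun=> phi (nseq i.+1 (pole i.+1)))).
  rewrite [X in _ (+) X](eq_hemisphere (ltnW iN) (psi := fun=> phi (nseq i.+1 (pole i.+1)))).
    by rewrite addbb.
  by move=> s [sz _ _]; rewrite TmE size_map sz.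
by move=> s [sz _ _]; rewrite TmE sz.
Qed.

(** Both hemispheres have the same boundary, since the equator is invariant under the antipodal
    map. *)
Lemma sphere_chain_cobound (i : nat) (psi : seq V -> bool) : (i <= N)%N ->
  sphere_chain i (cobound psi) = false.
Proof.
elim: i psi => [|i IH] psi iN; first by rewrite /sphere_chain /= !addbF addbb.
rewrite /sphere_chain hemisphere_cobound_step // => [|psi']; last exact: IH (ltnW iN).
have -> : hemisphere i.+1 (fun t => cobound psi (map -%R t)) =
    hemisphere i.+1 (cobound (fun t => psi (map -%R t))).
  by apply: eq_hemisphere => // s _; rewrite cobound_map.
rewrite hemisphere_cobound_step // => [|psi']; last exact: IH (ltnW iN).
by rewrite sphere_chainN ?addbb // ltnW.
Qed.

Lemma hemisphere_cobound (i : nat) (phi : seq V -> bool) : (i < N)%N ->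
  hemisphere i.+1 (cobound phi) = sphere_chain i phi.
Proof.
move=> iN; apply: hemisphere_cobound_step => // psi.
exact: sphere_chain_cobound (ltnW iN).
Qed.

(** Suppose there is no short complementary edge. By [cobound_fan], [theta] at s plus [theta] at -s
    is the coboundary of [theta] at s, so the value on the sphere of dimension i+1 equals that on
    its equator. It is odd in dimension 0, where the two points have opposite labels, yet it
    vanishes in dimension [N], where N+1 distinct indices would be required. *)
Lemma tucker (lab : V -> nat * bool) :
  (forall x, norm1 x = 1 -> lab (- x) = neg_label (lab x)) ->
  (forall x, norm1 x = 1 -> ((lab x).1 < N)%N) ->
  exists x y, [/\ norm1 x = 1, norm1 y = 1, norm1 (x - y) <= (2 * N)%:R / m%:R,
    (lab x).1 = (lab y).1 & (lab x).2 <> (lab y).2].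
Proof.
move=> lab_odd lab_lt; apply: contrapT => no_edge0.
have no_edge x y : ~ _ := fun h =>
  no_edge0 (ex_intro _ x (ex_intro _ y h)).

have no_compl i s : (i <= N)%N -> fine_simplex i s ->
    {in map lab s &, forall a b, a.1 = b.1 -> a.2 = b.2}.
  move=> iN [_ eq_s close] _ _ /mapP[x xs ->] /mapP[y ys ->] xy1.
  apply: contrapT => xy2; apply: (no_edge x y); split => //.
  - by case: (eq_s x xs).
  - by case: (eq_s y ys).
  - apply: le_trans (close x y xs ys) _.
    by rewrite ler_pM2r ?invr_gt0 ?ltr0n // ler_nat leq_mul2l iN orbT.
have labN i s : fine_simplex i s ->
    map lab (map -%R s) = map neg_label (map lab s).
  move=> [_ eq_s _]; rewrite -!map_comp; apply/eq_in_map => x xs /=.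
  by rewrite lab_odd //; case: (eq_s x xs).
pose theta s := fan (map lab s).
have step i : (i <= N)%N -> sphere_chain i theta = true.
  elim: i => [_|i IH iN].
    rewrite /sphere_chain /= /theta /= lab_odd ?norm1_pole //.
    by rewrite /fan /=; case: (lab _).2.
  rewrite -(IH (ltnW iN)) -[RHS]hemisphere_cobound // /sphere_chain -[LHS]hemisphereD //.
  apply: eq_hemisphere => // s fs.
  rewrite /theta (labN _ _ fs) (cobound_map lab) cobound_fan //; last exact: no_compl fs.
  by case: fs => sz _ _; rewrite -size_eq0 size_map sz.
have := step N (leqnn N); rewrite (eq_sphere_chain (psi := fun=> false)) //.
  by rewrite /sphere_chain addbb.
move=> s fs; apply: (fan_few_labels (N := N)); first exact: no_compl fs.
  by case: fs => _ eq_s _ _ /mapP[x xs ->]; apply: lab_lt; case: (eq_s x xs).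
by case: fs => sz _ _; rewrite size_map sz.
Qed.

End Hemispheres.

(** * Approximate zeros and convex combinations *)

(** If every point had a coordinate of F of size at least [delta], its index and sign would be an
    antipodal labelling. A complementary edge would then change one coordinate by at least 2
    [delta], against the Lipschitz bound on a fine mesh. *)
Lemma borsuk_ulam_approx (R : realType) (N : nat) (F : 'rV[R]_N.+1 -> 'rV[R]_N)
    (L delta : R) :
  0 <= L -> 0 < delta ->
  (forall x y j, `|F x 0 j - F y 0 j| <= L * norm1 (x - y)) ->
  (forall x, F (- x) = - F x) ->
  exists2 x, norm1 x = 1 & forall j, `|F x 0 j| < delta.
Proof.
move=> L0 delta0 lipF oddF; apply: contrapT => noF.
have big x : norm1 x = 1 -> exists j, delta <= `|F x 0 j|.
  move=> x1; apply: contrapT => nj; apply: noF; exists x => // j.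
  by rewrite ltNge; apply/negP => ?; apply: nj; exists j.
(* The default label never occurs on the unit sphere. The choice of j is the same at x and -x
   because the condition is even. *)
pose lab x := if [pick j | delta <= `|F x 0 j|] is Some j
  then (j : nat, 0 < F x 0 j) else (0%N, true).
have labP x : norm1 x = 1 ->
    exists2 j, delta <= `|F x 0 j| & lab x = (j : nat, 0 < F x 0 j).
  move=> /big[j0 hj0]; rewrite /lab; case: pickP => [j hj|/(_ j0)]; last by rewrite hj0.
  by exists j.
(* This makes [L] times the mesh 2N/m smaller than [delta]. *)
pose m := (Num.truncn (L * (2 * N)%:R / delta)).+1.
have m_gt0 : (0 < m)%N by [].
have [||x [y [x1 y1 xy lab1 lab2]]] := @tucker R N m m_gt0 lab.
- move=> x x1; have [j hj labx] := labP x x1; rewrite labx /lab.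
  have <- : [pick j | delta <= `|F x 0 j|] = [pick j | delta <= `|F (- x) 0 j|].
    by apply: eq_pick => i; rewrite oddF mxE normrN.
  move: labx; rewrite /lab; case: pickP => [i hi|/(_ j)]; last by rewrite hj.
  case=> /ord_inj -> _; rewrite /neg_label /= oddF mxE oppr_gt0.
  rewrite -leNgt lt_neqAle -[_ == 0]normr_eq0 gt_eqF //.
  exact: lt_le_trans hj.
- move=> x x1; have [j _ ->] := labP x x1; exact: ltn_ord.
have [i hi labx] := labP x x1; have [j hj laby] := labP y y1.
move: lab1 lab2; rewrite labx laby /= => /ord_inj ij; subst j.
have := lipF x y i.
have : L * norm1 (x - y) < delta.
  apply: le_lt_trans (ler_wpM2l L0 xy) _; rewrite mulrA ltr_pdivrMr ?ltr0n //.
  rewrite [ltRHS]mulrC -ltr_pdivrMr // /m.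
  exact: truncnS_gt.
move: (norm1 _) => z Lz lip.
move: hi hj lip; case: (ltP 0 (F x 0 i)) => Fx; case: (ltP 0 (F y 0 i)) => Fy //.
  rewrite (gtr0_norm Fx) (ler0_norm Fy) => hx hy h _.
  by have := ler_norm (F x 0 i - F y 0 i); lra.
rewrite (gtr0_norm Fy) (ler0_norm Fx) => hx hy h _.
by have := ler_norm (- (F x 0 i - F y 0 i)); rewrite normrN; lra.
Qed.

(** * Caratheodory's theorem *)

Lemma affine_dependence (R : fieldType) (l : nat) (I : finType) (A : {set I})
    (g : I -> 'rV[R]_l) : (l.+1 < #|A|)%N ->
  exists u : I -> R, [/\ exists p, u p != 0, forall p, p \notin A -> u p = 0,
    \sum_p u p = 0 & \sum_p u p *: g p = 0].
Proof.
(* A column of ones is appended, so that a linear relation between the rows also has coefficients of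
   sum zero. *)
move=> ltA; pose G : 'M[R]_(#|A|, l + 1) := \matrix_(i < #|A|) row_mx (g (enum_val i)) 1%:M.
have : kermx G != 0.
  rewrite kermx_eq0 /row_free; apply/eqP => rG.
  by have := rank_leq_col G; rewrite rG addn1 leqNgt ltA.
case/rowV0Pn => v /sub_kermxP vG /rV0Pn[i0 vi0].
pose u p := \sum_i v 0 i * (enum_val i == p)%:R.
have uE (W : lmodType R) (X : I -> W) :
    \sum_p u p *: X p = \sum_i v 0 i *: X (enum_val i).
  transitivity (\sum_p \sum_i (v 0 i * (enum_val i == p)%:R) *: X p).
    by apply: eq_bigr => p _; rewrite scaler_suml.
  rewrite exchange_big /=; apply: eq_bigr => i _.
  rewrite (bigD1 (enum_val i)) //= eqxx mulr1 big1 ?addr0 // => p /negPf pi.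
  by rewrite eq_sym pi mulr0 scale0r.
have vGE : \sum_i v 0 i *: row_mx (g (enum_val i)) 1%:M = 0 :> 'rV_(l + 1).
  rewrite -[RHS]vG mulmx_sum_row; apply: eq_bigr => i _; congr (_ *: _).
  by rewrite rowK.
exists u; split.
- exists (enum_val i0); rewrite /u (bigD1 i0) //= eqxx mulr1 big1 ?addr0 // => i ii0.
  by rewrite (inj_eq enum_val_inj) (negPf ii0) mulr0.
- move=> p pA; apply: big1 => i _; case: eqP => [ip|]; last by rewrite mulr0.
  by rewrite -ip enum_valP in pA.
- transitivity (\sum_p u p *: (1 : R^o)).
    by apply: eq_bigr => p _; rewrite /GRing.scale /= mulr1.
  rewrite uE; set z := LHS; suff -> : z = rsubmx (0 : 'rV[R]_(l + 1)) 0 0 by rewrite !mxE.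
  rewrite -vGE mxE summxE; apply: eq_bigr => i _.
  by rewrite mxE row_mxEr mxE eqxx.
- rewrite uE; apply/rowP => j; set z := LHS.
  suff -> : z = lsubmx (0 : 'rV[R]_(l + 1)) 0 j by rewrite !mxE.
  rewrite -vGE mxE /z !summxE; apply: eq_bigr => i _.
  by rewrite mxE [RHS]mxE row_mxEl.
Qed.

(** While the support is too large, subtract the multiple of an affine dependence at which the first
    weight vanishes; the sums are unchanged and the support shrinks. *)
Lemma caratheodory_support (R : realFieldType) (l : nat) (I : finType)
    (w : I -> R) (g : I -> 'rV[R]_l) :
  (forall p, 0 <= w p) ->
  exists w' : I -> R, [/\ forall p, 0 <= w' p, forall p, w p = 0 -> w' p = 0,
    \sum_p w' p = \sum_p w p, \sum_p w' p *: g p = \sum_p w p *: g p &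
    (#|[set p | w' p != 0%R]%SET| <= l.+1)%N].
Proof.
have [n] := ubnP #|[set p | w p != 0]%SET|; elim: n w => // n IH w ltn w0.
have [small|big] := leqP #|[set p | w p != 0]%SET| l.+1; first by exists w; split.
have [u [[p0 up0] uA u1 ug]] := affine_dependence g big.
have [p1 up1] : exists p, 0 < u p.
  apply: contrapT => nu; have : \sum_p - u p = 0 by rewrite sumrN u1 oppr0.
  move/eqP; rewrite psumr_eq0 => [/allP/(_ p0)|p _].
    by rewrite mem_index_enum oppr_eq0 (negPf up0) => /(_ isT).
  by rewrite oppr_ge0 leNgt; apply/negP => up; apply: nu; exists p.
pose q := [arg min_(p < p1 | 0 < u p) (w p / u p)]%O.
have [uq qmin] : 0 < u q /\ forall p, 0 < u p -> w q / u q <= w p / u p.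
  by rewrite /q; case: arg_minP.
pose t := w q / u q; have t0 : 0 <= t by rewrite divr_ge0 // ltW.
pose w1 p := w p - t * u p.
have w1supp p : w p = 0 -> w1 p = 0.
  by move=> wp; rewrite /w1 wp uA ?mulr0 ?subrr // inE wp eqxx.
have w1q : w1 q = 0 by rewrite /w1 /t divfK ?subrr // gt_eqF.
have [||w' [w'0 w'supp w'1 w'g w'card]] := IH w1.
- rewrite -ltnS; apply: leq_trans ltn; rewrite ltnS; apply: proper_card.
  apply/properP; split.
    by apply/fintype.subsetP => p; rewrite !inE; apply: contra_neq; exact: w1supp.
  exists q; rewrite inE ?w1q ?eqxx //.
  apply/negP => /eqP wq; have := uA q; rewrite inE wq eqxx => /(_ isT) uq0.
  by rewrite uq0 ltxx in uq.
- move=> p; rewrite subr_ge0; have [up|up] := ltP 0 (u p).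
    by rewrite -ler_pdivlMr //; exact: qmin.
  by apply: le_trans (w0 p); rewrite mulr_ge0_le0.
exists w'; split => //.
- by move=> p /w1supp; exact: w'supp.
- by rewrite w'1 sumrB -mulr_sumr u1 mulr0 subr0.
- rewrite w'g; transitivity (\sum_p (w p *: g p - t *: (u p *: g p))).
    by apply: eq_bigr => p _; rewrite scalerBl scalerA.
  by rewrite sumrB -scaler_sumr ug scaler0 subr0.
Qed.

Lemma caratheodory (R : realFieldType) (l : nat) (I : finType)
    (w : I -> R) (g : I -> 'rV[R]_l) :
  (forall p, 0 <= w p) -> \sum_p w p = 1 ->
  exists (h : 'I_l.+1 -> I) (a : 'I_l.+1 -> R),
    [/\ forall i, 0 <= a i, \sum_i a i = 1, forall i, 0 < w (h i) &
        \sum_i a i *: g (h i) = \sum_p w p *: g p].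
Proof.
move=> w0 w1; have [w' [w'0 w'supp]] := caratheodory_support g w0.
rewrite w1 => w'1 w'g; set A := [set p | _]%SET => cardA.
have [p0 p0A] : exists p0, p0 \in A.
  apply/existsP; rewrite -[[exists _, _]]negbK; apply/negP => /existsPn nA.
  move: w'1; rewrite big1 => [/eqP|p _]; first by rewrite eq_sym oner_eq0.
  by apply/eqP; have := nA p; rewrite inE negbK.
(* Indices beyond the support are sent to the default [p0], itself in the support, and get weight 0;
   so [w (h i)] is positive for every i. *)
pose h (i : nat) := nth p0 (enum A) i.
have hA i : h i \in A.
  have [iA|Ai] := ltnP i (size (enum A)); last by rewrite /h nth_default.
  by rewrite -(mem_enum A) mem_nth.
have hE (W : nmodType) (X : I -> W) : (forall p, w' p = 0 -> X p = 0) ->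
    \sum_(i < l.+1) (if (i < #|A|)%N then X (h i) else 0) = \sum_p X p.
  move=> X0; rewrite -big_mkcond -(big_ord_widen _ (fun i => X (h i))) //=.
  rewrite [RHS](bigID (mem A)) /= [X in _ = _ + X]big1 ?addr0; last first.
    by move=> p; rewrite inE negbK => /eqP; exact: X0.
  by rewrite -[RHS]big_enum [RHS](big_nth p0) big_mkord /h cardE.
exists (fun i => h i), (fun i => if (i < #|A|)%N then w' (h i) else 0); split.
- by move=> i; case: ifP.
- by rewrite hE.
- move=> i; rewrite lt_neqAle w0 andbT eq_sym; have := hA i; rewrite inE.
  by apply: contra_neq; exact: w'supp.
- rewrite -w'g -(hE _ (fun p => w' p *: g p)) => [|p ->]; last by rewrite scale0r.
  by apply: eq_bigr => i _; case: ifP; rewrite ?scale0r.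
Qed.

(** * Near-maximizers on a finite symmetric set *)

Definition lincomb (R : realType) (T : Type) (p : nat) (phi : 'I_p -> T -> R)
    (c : 'rV[R]_p) (y : T) : R := \sum_e c 0 e * phi e y.

Lemma lincombN (R : realType) (T : Type) (p : nat) (phi : 'I_p -> T -> R)
    (c : 'rV[R]_p) (y : T) : lincomb phi (- c) y = - lincomb phi c y.
Proof. by rewrite /lincomb -sumrN; apply: eq_bigr => e _; rewrite mxE mulNr. Qed.

Lemma lincomb_lip (R : realType) (T : Type) (p : nat) (phi : 'I_p.+1 -> T -> R)
    (c d : 'rV[R]_p.+1) (y : T) : (forall e, `|phi e y| <= 1) ->
  `|lincomb phi c y - lincomb phi d y| <= norm1 (c - d).
Proof.
move=> phi1; rewrite /lincomb -sumrB; apply: le_trans (ler_norm_sum _ _ _) _.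
apply: ler_sum => e _; rewrite -mulrBl normrM !mxE.
by rewrite ler_piMr.
Qed.

Lemma max0_lip (R : realType) (x y : R) : `|Num.max 0 x - Num.max 0 y| <= `|x - y|.
Proof.
have := ler_norm (x - y); have := ler_norm (- (x - y)); rewrite normrN ler_norml.
have := normr_ge0 (x - y); rewrite !maxEle.
by case: ifP => /idP x0; case: ifP => /idP y0 *; apply/andP; split; lra.
Qed.

(** The l+1 functions give a coefficient sphere of dimension l, to which Borsuk-Ulam applies with
    target dimension l. Negating [c] exchanges the weights of y and -y, which makes [F] odd; a point
    has positive weight only if it is within [eps] of the maximum. *)
Lemma approx_hull (R : realType) (T : zmodType) (S : T -> Prop) (l : nat)
    (phi : 'I_l.+1 -> T -> R) (f : T -> 'rV[R]_l) (Y : seq T) (eps : R) :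
  (forall y, S y -> S (- y)) ->
  (forall e y, S y -> phi e (- y) = - phi e y) ->
  (forall e y, S y -> `|phi e y| <= 1) ->
  (forall y, S y -> f (- y) = - f y) ->
  0 < eps -> (0 < size Y)%N -> {in Y, forall y, S y} ->
  exists (c : 'rV[R]_l.+1) (a : 'I_l.+1 -> R) (x : 'I_l.+1 -> T),
    [/\ norm1 c = 1, (forall i, 0 <= a i) /\ \sum_i a i = 1, forall i, S (x i),
      forall j, `|\sum_i a i * f (x i) 0 j| <= eps &
      forall i, {in Y, forall y, lincomb phi c y <= lincomb phi c (x i) + eps}].
Proof.
move=> SN phi_odd phi1 f_odd eps0 Y0 YS.
pose I := ('I_(size Y) * bool)%type.
pose pt (p : I) : T := if p.2 then tnth (in_tuple Y) p.1 else - tnth (in_tuple Y) p.1.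
pose opp (p : I) : I := (p.1, ~~ p.2).
have oppK : involutive opp by case=> j b; rewrite /opp /= negbK.
have ptS p : S (pt p) by rewrite /pt; case: ifP => _; [|apply: SN]; apply: YS; exact: mem_tnth.
have pt_opp p : pt (opp p) = - pt p by rewrite /pt /=; case: p.2; rewrite ?opprK.
pose P c p := lincomb phi c (pt p).
have P_opp c p : P c (opp p) = - P c p.
  rewrite /P /lincomb pt_opp -sumrN; apply: eq_bigr => e _.
  by rewrite phi_odd // mulrN.
have PN c p : P (- c) p = P c (opp p) by rewrite P_opp /P lincombN.
have P_lip c d p : `|P c p - P d p| <= norm1 (c - d).
  by apply: lincomb_lip => e; exact: phi1.
(* The default 0 is harmless: the point set is symmetric, so the largest value is nonnegative. *)
pose M c := \big[Num.max/0]_p P c p.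
have M_le c p : P c p <= M c by exact: le_bigmax.
have MN c : M (- c) = M c.
  rewrite /M (reindex_inj (inv_inj oppK)) /=; apply: eq_bigr => p _.
  by rewrite PN oppK.
have n0 (z : 'rV[R]_l.+1) : 0 <= norm1 z by apply: sumr_ge0.
have M_le_lip c d : M c <= M d + norm1 (c - d).
  apply/bigmax_leP; split=> [|p _].
    by apply: addr_ge0 => //; exact: bigmax_ge_id.
  have := P_lip c d p; have := ler_norm (P c p - P d p); have := M_le d p; lra.
have norm1C (c d : 'rV[R]_l.+1) : norm1 (c - d) = norm1 (d - c) by rewrite -opprB norm1N.
have M_lip c d : `|M c - M d| <= norm1 (c - d).
  rewrite ler_norml; apply/andP; split.
    by have := M_le_lip d c; rewrite norm1C; lra.
  by have := M_le_lip c d; lra.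
pose w c p := Num.max 0 (P c p - M c + eps).
have w0 c p : 0 <= w c p by rewrite le_max lexx.
have w_lip c d p : `|w c p - w d p| <= 2 * norm1 (c - d).
  apply: le_trans (max0_lip _ _) _.
  rewrite (_ : _ - _ = (P c p - P d p) - (M c - M d)); last by ring.
  by apply: le_trans (ler_normB _ _) _; rewrite mulr_natl mulr2n lerD.
pose F c := \sum_p w c p *: f (pt p).
pose L := \sum_j \sum_p 2 * `|f (pt p) 0 j|.
have L0 : 0 <= L by apply: sumr_ge0 => j _; apply: sumr_ge0 => p _; rewrite mulr_ge0.
have F_lip c d j : `|F c 0 j - F d 0 j| <= L * norm1 (c - d).
  apply: le_trans (_ : (\sum_p 2 * `|f (pt p) 0 j|) * norm1 (c - d) <= _); last first.
    apply: ler_wpM2r => //; rewrite /L (bigD1 j) //= lerDl.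
    by apply: sumr_ge0 => i _; apply: sumr_ge0 => p _; rewrite mulr_ge0.
  rewrite !summxE -sumrB mulr_suml; apply: le_trans (ler_norm_sum _ _ _) _.
  apply: ler_sum => p _; rewrite !mxE -mulrBl normrM mulrAC.
  exact: ler_wpM2r.
have FN c : F (- c) = - F c.
  rewrite /F (reindex_inj (inv_inj oppK)) /= -sumrN; apply: eq_bigr => p _.
  by rewrite pt_opp f_odd // scalerN /w MN PN oppK.
(* The tolerance is the square of [eps]: normalizing the weights divides by [W], which is at least
   [eps] because a maximizer has weight at least [eps]. *)
have [c c1 Fc] := borsuk_ulam_approx L0 (mulr_gt0 eps0 eps0) F_lip FN.
have [p1 wp1] : exists p, eps <= w c p.
  have [p _ pmax] := @arg_maxP _ _ I ((Ordinal Y0, true) : I) xpredT (P c) isT.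
  exists p; rewrite /w le_max; apply/orP; right; rewrite lerDr subr_ge0.
  apply/bigmax_leP; split=> [|q _]; last exact: pmax.
  have := pmax (opp p) isT; rewrite P_opp => h.
  by have : - P c p <= P c p := h; lra.
pose W := \sum_p w c p.
have epsW : eps <= W.
  apply: le_trans wp1 _; rewrite /W (bigD1 p1) //= lerDl.
  by apply: sumr_ge0.
have W0 : 0 < W := lt_le_trans eps0 epsW.
have [||h [a [a0 a1 ah aE]]] := @caratheodory R l I (fun p => w c p / W) (fun p => f (pt p)).
- by move=> p; rewrite divr_ge0 // ltW.
- by rewrite -mulr_suml divff // gt_eqF.
exists c, a, (fun i => pt (h i)); split => // [j|i y yY].
  have -> : \sum_i a i * f (pt (h i)) 0 j = F c 0 j / W.
    transitivity ((\sum_i a i *: f (pt (h i))) 0 j).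
      by rewrite summxE; apply: eq_bigr => i _; rewrite mxE.
    rewrite aE !summxE mulr_suml; apply: eq_bigr => p _.
    by rewrite !mxE mulrAC.
  rewrite normrM normfV (gtr0_norm W0) ler_pdivrMr //.
  by apply: le_trans (ltW (Fc j)) _; rewrite ler_pM2l.
have := ah i; rewrite pmulr_lgt0 ?invr_gt0 // /w lt_max ltxx /= => hi.
have [k yk] : exists k : 'I_(size Y), y = tnth (in_tuple Y) k by apply/tnthP.
have := M_le c (k, true); rewrite /P /pt /= -yk -/(pt (h i)) -/(P c (h i)).
by move: hi; rewrite /P; lra.
Qed.

(** * Passing to the limit *)

Lemma ultra_fmap (T U : Type) (g : T -> U) (F : set_system T) :
  UltraFilter F -> UltraFilter (g @ F).
Proof.
move=> FU; split; first exact: fmap_proper_filter.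
move=> G GF sFG; rewrite predeqE => A; split; last exact: sFG.
move=> GA; have [//|FnA] := in_ultra_setVsetC (g @^-1` A) FU.
have GnA : G (~` A) by exact: sFG.
by have /filter_ex[? []] : G (A `&` ~` A) by exact: filterI.
Qed.

Lemma ultra_compact_cvg (J : Type) (T : topologicalType) (F : set_system J)
    (A : set T) (g : J -> T) :
  UltraFilter F -> compact A -> (forall q, A (g q)) ->
  exists2 p, A p & g q @[q --> F] --> p.
Proof.
rewrite compact_ultra => FU cA gA; have gF := ultra_fmap g FU.
have [p [Ap gp]] := cA _ gF (filterE _ gA).
by exists p.
Qed.

Lemma cvg_sum_fin (R : realType) (J : Type) (F : set_system J) (I : Type)
    (r : seq I) (g : I -> J -> R) (l : I -> R) : Filter F ->
  (forall i, g i q @[q --> F] --> l i) ->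
  \sum_(i <- r) g i q @[q --> F] --> \sum_(i <- r) l i.
Proof.
move=> FF gl; elim: r => [|i r IH].
  by rewrite big_nil; under eq_cvg do rewrite big_nil; exact: cvg_cst.
by rewrite big_cons; under eq_cvg do rewrite big_cons; exact: cvgD.
Qed.

Lemma ler_cvg_near (R : realType) (J : Type) (F : set_system J)
    (g h : J -> R) (a b : R) : ProperFilter F ->
  g q @[q --> F] --> a -> h q @[q --> F] --> b ->
  (\forall q \near F, g q <= h q) -> a <= b.
Proof.
move=> FF ga hb gh; rewrite -subr_ge0; apply: (cvgr_to_ge (cvgB hb ga)).
by apply: filterS gh => q; rewrite subr_ge0.
Qed.

(** Coefficients, weights and points all range over compact sets, so they converge together along an
    ultrafilter on the pairs (list, precision). The number of points stays l+1, so the sums pass to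
    the limit. *)
Lemma extremal_hull (R : realType) (d l : nat) (S : set 'rV[R]_d)
    (phi : 'I_l.+1 -> 'rV[R]_d -> R) (f : 'rV[R]_d -> 'rV[R]_l) :
  compact S -> S !=set0 -> (forall y, S y -> S (- y)) ->
  (forall e, continuous (phi e)) ->
  (forall e y, S y -> phi e (- y) = - phi e y) ->
  (forall e y, S y -> `|phi e y| <= 1) ->
  (forall y, S y -> f (- y) = - f y) ->
  {within S, continuous f} ->
  exists2 c, norm1 c = 1 & conv_hull
    (f @` [set x | S x /\ forall y, S y -> lincomb phi c y <= lincomb phi c x]) 0.
Proof.
move=> Scpt [x0 Sx0] SN phi_cont phi_odd phi1 f_odd f_cont.
pose J := (seq 'rV[R]_d * nat)%type.
(* Adding [x0] keeps the list nonempty. *)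
pose Y (q : J) := x0 :: [seq y <- q.1 | `[< S y >]].
pose eps (q : J) : R := q.2.+1%:R^-1.
have YS q : {in Y q, forall y, S y}.
  by move=> y; rewrite inE => /orP[/eqP->//|]; rewrite mem_filter => /andP[/asboolP].
have eps0 q : 0 < eps q by rewrite invr_gt0 ltr0n.
have /choice[t tP] : forall q,
    exists t : 'rV[R]_l.+1 * ('I_l.+1 -> R) * ('I_l.+1 -> 'rV[R]_d),
    [/\ norm1 t.1.1 = 1, (forall i, 0 <= t.1.2 i) /\ \sum_i t.1.2 i = 1,
      forall i, S (t.2 i), forall j, `|\sum_i t.1.2 i * f (t.2 i) 0 j| <= eps q &
      forall i, {in Y q, forall y,
        lincomb phi t.1.1 y <= lincomb phi t.1.1 (t.2 i) + eps q}].
  move=> q; have [//|c [a [x h]]] :=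
    approx_hull SN phi_odd phi1 f_odd (eps0 q) _ (@YS q).
  by exists (c, a, x).
(* Along this filter every given point is eventually listed and the precision tends to 0; hence the
   limit points maximize over all of [S]. *)
pose G : set_system J := filter_from setT
  (fun k : J => [set q : J | {subset k.1 <= q.1} /\ (k.2 <= q.2)%N]).
have GP : ProperFilter G.
  apply: filter_from_proper => [|k _]; last by exists k; split.
  apply: filter_fromT_filter; first by exists ([::], 0%N).
  move=> [s m] [s' m']; exists (s ++ s', maxn m m') => -[u n] /= [su].
  rewrite geq_max => /andP[mn m'n]; split; split => // y ys; apply: su;
  by rewrite mem_cat ys ?orbT.
have [U [UU GU]] := ultraFilterLemma GP.
have UF : ProperFilter U by exact: ultra_proper.
have near_ge (k : J) : U [set q : J | {subset k.1 <= q.1} /\ (k.2 <= q.2)%N].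
  by apply: GU; exists k.
have eps_cvg : eps q @[q --> U] --> 0.
  apply/cvgr0Pnorm_le => e e0.
  have := near_ge ([::], Num.truncn e^-1); apply: filterS => q /= [_ nq].
  rewrite ger0_norm ?(ltW (eps0 _)) // /eps invf_ple ?posrE ?ltr0n //.
  apply: le_trans (ltW (truncnS_gt _)) _.
  by rewrite ler_nat ltnS.
have [c _ cc] : exists2 c : 'rV[R]_l.+1, True & (t q).1.1 @[q --> U] --> c.
  have [||c cA cc] := @ultra_compact_cvg J _ U
      [set v : 'rV[R]_l.+1 | forall e, `[-1, 1]%classic (v ord0 e)] (fun q => (t q).1.1) UU.
  - by apply: (@rV_compact _ _ (fun=> `[(-1 : R), 1]%classic)) => e; exact: segment_compact.
  - move=> q e /=; have [c1 _ _ _ _] := tP q.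
    rewrite in_itv /= -ler_norml -c1 /norm1 (bigD1 e) //= lerDl.
    by apply: sumr_ge0.
  by exists c.
have [a a_cvg] : exists a, forall i, (t q).1.2 i @[q --> U] --> (a i : R).
  suff /choice[a aP] : forall i, exists a : R, (t q).1.2 i @[q --> U] --> a by exists a.
  move=> i; have [|q|a _ aa] := @ultra_compact_cvg J R U `[0, 1]
      (fun q => (t q).1.2 i) UU.
  - exact: segment_compact.
  - rewrite /= in_itv /=; have [_ [a0 a1] _ _ _] := tP q.
    by rewrite a0 -a1 (bigD1 i) //= lerDl sumr_ge0.
  by exists a.
have [x xP] : exists x, forall i, S (x i) /\ (t q).2 i @[q --> U] --> (x i : 'rV[R]_d).
  suff /choice[x xP] : forall i, exists x : 'rV[R]_d,
    S x /\ (t q).2 i @[q --> U] --> x by exists x.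
  move=> i; have [//|q|x Sx xx] := @ultra_compact_cvg J _ U S (fun q => (t q).2 i) UU.
    by have [_ _ xS _ _] := tP q.
  by exists x.
have xS q i : S ((t q).2 i) by have [_ _ h _ _] := tP q.
have coord_cvg e : (t q).1.1 0 e @[q --> U] --> c 0 e.
  exact: (cvg_comp _ _ cc (@coord_continuous R 1 l.+1 0 e c)).
have P_cvg (g : J -> 'rV[R]_d) z : g q @[q --> U] --> z ->
    lincomb phi (t q).1.1 (g q) @[q --> U] --> lincomb phi c z.
  move=> gz; apply: cvg_sum_fin => e; apply: cvgM => //.
  exact: (cvg_comp _ _ gz (phi_cont e z)).
(* Continuity of [f] within [S] suffices, since all the approximating points lie in [S]. *)
have fx_cvg i j : f ((t q).2 i) 0 j @[q --> U] --> f (x i) 0 j.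
  have [Sxi xi] := xP i.
  have := @cvg_comp _ _ _ (fun q => f ((t q).2 i))
    (fun M : 'rV[R]_l => M 0 j) U (nbhs (f (x i))) _ _.
  apply; last exact: coord_continuous.
  have /subspace_continuousP/(_ _ Sxi) h := f_cont.
  apply: (cvg_comp (fun q => (t q).2 i) f _ h).
  move=> A wA; have : U (fun q => S ((t q).2 i) -> A ((t q).2 i)) by exact: xi wA.
  by apply: (@filterS _ U) => q; apply; exact: xS.
have c1 : norm1 c = 1.
  apply: (@cvg_unique R (@norm_hausdorff _ _) (norm1 (t q).1.1 @[q --> U])).
    by apply: cvg_sum_fin => e; apply: cvg_norm.
  apply: cvg_near_cst; apply: filterE => q.
  by have [] := tP q.
have a0 i : 0 <= a i.
  apply: (cvgr_to_ge (a_cvg i)); apply: filterE => q.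
  by have [_ []] := tP q.
have a1 : \sum_i a i = 1.
  apply: (@cvg_unique R (@norm_hausdorff _ _) (\sum_i (t q).1.2 i @[q --> U])).
    exact: cvg_sum_fin.
  apply: cvg_near_cst; apply: filterE => q.
  by have [_ []] := tP q.
have af j : \sum_i a i * f (x i) 0 j = 0.
  apply/eqP; rewrite -normr_le0.
  apply: (@ler_cvg_near R J U (fun q => `|\sum_i (t q).1.2 i * f ((t q).2 i) 0 j|) eps _ _ UF) => //.
    by apply: cvg_norm; apply: cvg_sum_fin => i; apply: cvgM.
  by apply: filterE => q; have [] := tP q.
exists c => //; exists l.+1, a, (fun i => f (x i)); split => // [i|].
  exists (x i) => //; split; first by have [] := xP i.
  move=> y Sy; apply: (@ler_cvg_near R J U (fun q => lincomb phi (t q).1.1 y)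
     (fun q => lincomb phi (t q).1.1 ((t q).2 i) + eps q) _ _ UF).
  - by apply: P_cvg; exact: cvg_cst.
  - rewrite -[X in _ --> X]addr0; apply: cvgD => //.
    by apply: P_cvg; have [] := xP i.
  - have := near_ge ([:: y], 0%N); apply: filterS => q /= [yq _].
    have [_ _ _ _ h] := tP q; apply: h.
    by rewrite inE mem_filter yq ?inE // andbT; apply/orP; right; apply/asboolP.
by apply/rowP => j; rewrite mxE summxE -[LHS](af j); apply: eq_bigr => i _; rewrite mxE.
Qed.

(** * Trigonometric polynomials *)

Lemma size_mul_le_deg (R : idomainType) (p q : {poly R}) (m n : nat) :
  (size p <= m.+1)%N -> (size q <= n.+1)%N -> (size (p * q)%R <= (m + n).+1)%N.
Proof. by move=> pm qn; have := size_polyMleq p q; lia. Qed.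

Lemma size_exp_le_deg (R : idomainType) (p : {poly R}) (m n : nat) :
  (size p <= m.+1)%N -> (size (p ^+ n)%R <= (m * n).+1)%N.
Proof.
move=> pm; apply: leq_trans (size_poly_exp_leq p n) _.
by rewrite ltnS leq_mul2r; apply/orP; right; lia.
Qed.

(** By the addition formulas both functions are forms of degree m in cos t and sin t. Dividing by
    the m-th power of sin t turns zeros in (0, pi) into roots of a polynomial in cot t. *)
Lemma cos_sin_natmul (R : realType) (m : nat) : exists A B : {poly R},
  [/\ (size A <= m.+1)%N, (size B <= m.+1)%N &
    forall t : R, sin t != 0 ->
      cos (m%:R * t) = sin t ^+ m * A.[cos t / sin t] /\
      sin (m%:R * t) = sin t ^+ m * B.[cos t / sin t]].
Proof.
elim: m => [|m [A [B [sA sB AB]]]].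
  exists 1, 0; rewrite size_poly1 size_poly0; split => // t _.
  by rewrite !mul0r cos0 sin0 !hornerE ?expr0 ?mulr1 ?mulr0.
exists ('X * A - B), ('X * B + A).
have sX (p : {poly R}) : (size p <= m.+1)%N -> (size ('X * p)%R <= m.+2)%N.
  by rewrite mulrC => h; apply: leq_trans (size_polyMleq _ _) _; rewrite size_polyX; lia.
split.
- by apply: leq_trans (size_polyD _ _) _; rewrite size_polyN geq_max sX //= leqW.
- by apply: leq_trans (size_polyD _ _) _; rewrite geq_max sX //= leqW.
move=> t t0; have [cm sm] := AB t t0.
have -> : m.+1%:R * t = m%:R * t + t by rewrite -natr1 mulrDl mul1r.
rewrite cosD sinD cm sm !hornerE exprS; split; field; exact: t0.
Qed.

Lemma cot_inj (R : realType) (x y : R) :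
  0 < x < pi -> 0 < y < pi -> cos x / sin x = cos y / sin y -> x = y.
Proof.
wlog xy : x y / x < y.
  move=> H x0 y0 xy; case: (ltgtP x y) => [lt|lt|//]; first exact: (H x y).
  by apply/esym; apply: (H y x).
move=> /andP[x0 xp] /andP[y0 yp].
have sx : 0 < sin x by rewrite sin_gt0_pi ?x0.
have sy : 0 < sin y by rewrite sin_gt0_pi ?y0.
move/eqP; rewrite eqr_div ?lt0r_neq0 // => /eqP e.
have : 0 < sin (y - x) by apply: sin_gt0_pi; apply/andP; split; lra.
by rewrite sinB subr_gt0 [sin y * _]mulrC e ltxx.
Qed.

Lemma cos_natpi (R : realType) (j : nat) : cos (j%:R * pi : R) = (-1) ^+ j.
Proof.
elim: j => [|j IH]; first by rewrite mul0r cos0.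
by rewrite -natr1 mulrDl mul1r cosDpi IH exprS mulN1r.
Qed.

(* M. Riesz: otherwise a slight contraction of a translate of g would cross
   M cos (m t) three times inside (0, pi/m), and hence m + 2 times in (0, pi). *)
Lemma riesz_max_min (R : realType) (m : nat) (g : R -> R) (M b : R) :
  (0 < m)%N -> 0 < M -> continuous g -> (forall t, `|g t| <= M) ->
  (forall s, exists2 q : {poly R}, (size q <= m.+1)%N &
    forall t, sin t != 0 -> g (t - s) = sin t ^+ m * q.[cos t / sin t]) ->
  0 < b -> g 0 = M -> g b = - M -> pi / m%:R <= b.
Proof.
move=> m0 M0 gc gM gq b0 g0 gb; rewrite leNgt; apply/negP => bm.
have mR : 0 < m%:R :> R by rewrite ltr0n.
(* Translating by [s] puts the maximum at s and the minimum at pi/m - s, where cos (m t) takes the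
   opposite values [kappa] and -[kappa]. *)
pose s := (pi / m%:R - b) / 2; have s0 : 0 < s by rewrite /s; lra.
have sb : s + b = pi / m%:R - s by rewrite /s; lra.
have ms0 : 0 < m%:R * s by rewrite mulr_gt0.
have msp : m%:R * s < pi.
  by rewrite mulrC -ltr_pdivlMr //; rewrite /s; lra.
pose kappa := cos (m%:R * s).
have k1 : kappa < 1.
  rewrite -(cos0 R) /kappa ltr_cos // ?in_itv /=; apply/andP; split; lra.
have kN1 : -1 < kappa.
  rewrite -(@cospi R) /kappa ltr_cos // ?in_itv /= ?pi_ge0 ?lexx //; apply/andP; split; lra.
(* Any factor strictly between [kappa] and 1, and positive, would do: at s and s + b the contracted
   g still exceeds M cos (m t) in size, but it stays strictly below M everywhere. *)
pose lam := (1 + kappa) / 2.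
have lam0 : 0 < lam by rewrite /lam; lra.
have lam1 : lam < 1 by rewrite /lam; lra.
have lamk : kappa < lam by rewrite /lam; lra.
pose h t := lam * g (t - s) - M * cos (m%:R * t).
have hc : continuous h.
  move=> t; apply: cvgB.
    apply: cvgM; first exact: cvg_cst.
    apply: (@cvg_comp _ _ _ (fun t => t - s) g _ (nbhs (t - s))); last exact: gc.
    by apply: cvgB; [exact: cvg_id|exact: cvg_cst].
  apply: cvgM; first exact: cvg_cst.
  apply: (@cvg_comp _ _ _ (fun t => m%:R * t) cos _ (nbhs (m%:R * t))); last exact: continuous_cos.
  by apply: cvgM; [exact: cvg_cst|exact: cvg_id].
have lamg t : `|lam * g t| < M.
  rewrite normrM (gtr0_norm lam0); apply: le_lt_trans (_ : lam * M < _).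
    by rewrite ler_pM2l.
  by rewrite gtr_pMl.
(* The nodes are 0, s, s + b, pi/m, 2 pi/m, ..., pi, the last with index m+2. The sign of [h]
   alternates along them, which gives m+2 zeros, too many for the polynomial [Q] of degree at most
   m. *)
pose x (i : nat) : R := match i with
  | 0 => 0 | 1 => s | 2 => s + b | j.+2 => j%:R * (pi / m%:R) end.
have x_lt i : x i < x i.+1.
  case: i => [|[|[|j]]] //=; first by rewrite ltrDl.
    by rewrite mul1r sb ltrBlDr ltrDl.
  by rewrite ltr_pM2r ?divr_gt0 ?pi_gt0 // ltr_nat.
have x_mono : {homo x : i j / (i < j)%N >-> i < j}.
  by apply: homo_ltn => //; exact: lt_trans.
have x_le : {homo x : i j / (i <= j)%N >-> i <= j}.
  by move=> i j; rewrite leq_eqVlt => /orP[/eqP->//|/x_mono/ltW].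
have x_end : x m.+2 = pi.
  have : x m.-1.+3 = m.-1.+1%:R * (pi / m%:R) by [].
  by rewrite prednK // mulrC divfK // gt_eqF.
have h_sign i : (-1) ^+ i * h (x i) < 0.
  case: i => [|[|[|j]]]; rewrite /h.
  - rewrite /= mulr0 cos0 expr0 mul1r.
    by have := lamg (0 - s); rewrite ltr_norml => /andP[]; lra.
  - rewrite /= subrr g0 expr1 mulN1r -/kappa.
    have : 0 < M * (lam - kappa) by rewrite mulr_gt0 // subr_gt0.
    lra.
  - have -> : x 2%N - s = b by rewrite /x; ring.
    have -> : m%:R * x 2%N = - (m%:R * s) + pi.
      by rewrite /x sb mulrBr mulrCA divff ?mulr1 1?addrC // gt_eqF.
    rewrite gb cosDpi cosN -/kappa sqrrN expr1n mul1r.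
    have : 0 < M * (lam - kappa) by rewrite mulr_gt0 // subr_gt0.
    lra.
  - have -> : m%:R * x j.+3 = j.+1%:R * pi.
      by rewrite /= mulrC -mulrA divfK // gt_eqF.
    rewrite cos_natpi !exprS -(signr_odd _ j).
    have := lamg (x j.+3 - s); move: (lam * g _) => v; rewrite ltr_norml.
    by case: (odd j); rewrite /= ?expr0 ?expr1 => /andP[]; lra.
have root_ex i : (i < m.+2)%N -> exists2 z, x i < z < x i.+1 & h z = 0.
  move=> im; have xi := ltW (x_lt i).
  have hi := h_sign i; have hi1 := h_sign i.+1.
  rewrite exprS mulN1r mulNr oppr_lt0 in hi1.
  have ne (z : R) : h z = 0 -> (x i != z) && (z != x i.+1).
    move=> hz; apply/andP; split; apply/eqP => e.
      by rewrite e hz mulr0 ltxx in hi.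
    by rewrite -e hz mulr0 ltxx in hi1.
  have [|z] := @IVT R h (x i) (x i.+1) 0 xi (continuous_subspaceT hc).
    move: hi hi1; rewrite -signr_odd ge_min le_max; case: (odd i).
      by rewrite expr1 !mulN1r oppr_lt0 oppr_gt0 => /ltW -> /ltW ->; rewrite !orbT.
    by rewrite expr0 !mul1r => /ltW -> /ltW ->; rewrite !orbT.
  rewrite in_itv /= => /andP[z1 z2] hz; have /andP[n1 n2] := ne z hz.
  by exists z => //; rewrite !lt_neqAle n1 z1 n2 z2.
have /choice[z zP] : forall i, exists z, (i < m.+2)%N -> x i < z < x i.+1 /\ h z = 0.
  move=> i; have [im|_] := ltnP i m.+2; last by exists 0.
  by have [z z1 z2] := root_ex i im; exists z.
have z_pi i : (i < m.+2)%N -> 0 < z i < pi.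
  move=> im; have [/andP[z1 z2] _] := zP i im; apply/andP; split.
    by apply: le_lt_trans z1; exact: (x_le 0%N).
  by rewrite -x_end; apply: lt_le_trans z2 _; exact: x_le.
have z_mono i j : (i < j)%N -> (j < m.+2)%N -> z i < z j.
  move=> ij jm; have [/andP[_ z1] _] := zP i (ltn_trans ij jm).
  have [/andP[z2 _] _] := zP j jm.
  by apply: lt_trans z1 (le_lt_trans _ z2); exact: x_le.
have [q sq qP] := gq s; have [A [B [sA _ AP]]] := cos_sin_natmul R m.
pose Q := lam *: q - M *: A.
have hQ t : sin t != 0 -> h t = sin t ^+ m * Q.[cos t / sin t].
  move=> t0; rewrite /h /Q qP // (AP t t0).1 hornerD hornerN !hornerZ; ring.
have sin0z (t : R) : 0 < t < pi -> sin t != 0.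
  by move=> t0; rewrite gt_eqF // sin_gt0_pi.
pose rs := [seq cos (z i) / sin (z i) | i <- iota 0 m.+2].
have Q0 : Q = 0.
  apply: contraTeq isT => Qn0.
  have : (size rs < size Q)%N.
    apply: max_poly_roots => //.
      apply/allP => u /mapP[i]; rewrite mem_iota add0n => /= im ->.
      have := hQ (z i) (sin0z (z i) (z_pi i im)); rewrite (zP i im).2 => /esym/eqP.
      by rewrite mulf_eq0 expf_eq0 (negPf (sin0z (z i) (z_pi i im))) andbF.
    rewrite map_inj_in_uniq ?iota_uniq // => i j; rewrite !mem_iota !add0n /= => im jm.
    move=> /(cot_inj (z_pi i im) (z_pi j jm)) zij; case: (ltngtP i j) => // ij.
      by have := z_mono i j ij jm; rewrite zij ltxx.
    by have := z_mono j i ij im; rewrite zij ltxx.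
  rewrite size_map size_iota ltnNge; apply: contraNN => _.
  apply: leq_trans (size_polyD _ _) _; rewrite size_polyN geq_max.
  by rewrite !(leq_trans (size_scale_leq _ _)) // leqW.
(* Now [h] vanishes at s, where it must be positive. *)
have := h_sign 1%N; rewrite hQ ?Q0 ?horner0 ?mulr0 ?ltxx //.
apply: sin0z; rewrite /= s0 /=; apply: lt_trans (_ : s + b < _); first by rewrite ltrDl.
rewrite sb; apply: lt_le_trans (_ : pi / m%:R <= _); first by rewrite ltrBlDr ltrDl.
by rewrite ler_pdivrMr // ler_peMr ?pi_ge0 // ler1n.
Qed.

(** * Odd polynomials on the sphere *)

Section Dot.
Variables (R : realType) (d : nat).
Implicit Types x y z : 'rV[R]_d.

Lemma dotC x y : dot x y = dot y x.
Proof. by apply: eq_bigr => i _; rewrite mulrC. Qed.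

Lemma dotDl x y z : dot (x + y) z = dot x z + dot y z.
Proof. by rewrite /dot -big_split; apply: eq_bigr => i _; rewrite mxE mulrDl. Qed.

Lemma dotZl a x y : dot (a *: x) y = a * dot x y.
Proof. by rewrite /dot mulr_sumr; apply: eq_bigr => i _; rewrite mxE mulrA. Qed.

Lemma dotDr x y z : dot z (x + y) = dot z x + dot z y.
Proof. by rewrite dotC dotDl !(dotC z). Qed.

Lemma dotZr a x y : dot y (a *: x) = a * dot y x.
Proof. by rewrite dotC dotZl dotC. Qed.

Lemma dotNl x y : dot (- x) y = - dot x y.
Proof. by rewrite -scaleN1r dotZl mulN1r. Qed.

Lemma dotNr x y : dot y (- x) = - dot y x.
Proof. by rewrite dotC dotNl dotC. Qed.

Lemma dot_ge0 x : 0 <= dot x x.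
Proof. by apply: sumr_ge0 => i _; rewrite -expr2 sqr_ge0. Qed.

Lemma dot_eq0 x : dot x x = 0 -> x = 0.
Proof.
move/eqP; rewrite psumr_eq0 => [/allP x0|i _]; last by rewrite -expr2 sqr_ge0.
apply/rowP => i; have := x0 i; rewrite mem_index_enum mulf_eq0 orbb mxE.
by move=> /(_ isT) /eqP.
Qed.

Lemma unit_sphereN x : unit_sphere R d x -> unit_sphere R d (- x).
Proof. by rewrite /unit_sphere /= dotNl dotNr opprK. Qed.

Lemma unit_sphere_coord x i : unit_sphere R d x -> `|x 0 i| <= 1.
Proof.
move=> x1; rewrite -(@expr_le1 _ 2) // real_normK ?num_real // -x1 /dot (bigD1 i) //=.
by rewrite expr2 lerDl; apply: sumr_ge0 => j _; rewrite -expr2 sqr_ge0.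
Qed.

Lemma unit_sphere_compact : compact (unit_sphere R d).
Proof.
apply: (@subclosed_compact _ _ [set v : 'rV[R]_d | forall i, `[-1, 1]%classic (v ord0 i)]).
- apply: (@closed_comp _ _ (fun x : 'rV[R]_d => dot x x) [set 1]); last exact: closed_eq.
  move=> x _; apply: (@cvg_sum_fin _ _ (nbhs x)) => i.
  by apply: cvgM; exact: coord_continuous.
- by apply: (@rV_compact _ _ (fun=> `[(-1 : R), 1]%classic)) => i; exact: segment_compact.
- by move=> x x1 i /=; rewrite in_itv /= -ler_norml; exact: unit_sphere_coord.
Qed.

Lemma unit_sphere_dot x y : unit_sphere R d x -> unit_sphere R d y ->
  -1 <= dot x y <= 1.
Proof.
move=> x1 y1; apply/andP; split.
  have := dot_ge0 (x + y); rewrite dotDl !dotDr (dotC y x) x1 y1; lra.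
have := dot_ge0 (x - y); rewrite dotDl !dotDr !dotNl !dotNr (dotC y x) x1 y1; lra.
Qed.

Lemma great_circle x e t : unit_sphere R d x -> unit_sphere R d e ->
  dot x e = 0 -> unit_sphere R d (cos t *: x + sin t *: e).
Proof.
move=> x1 e1 xe; rewrite /unit_sphere /= dotDl !dotDr !dotZl !dotZr (dotC e x) xe x1 e1.
by rewrite !mulr0 addr0 add0r !mulr1 -!expr2 cos2Dsin2.
Qed.

End Dot.

Section OddPowers.
Variables (R : realType) (d p k : nat) (ri : 'I_p -> 'I_d) (ci : 'I_p -> nat).
Hypothesis ci_le : forall e, (ci e <= k)%N.

Definition odd_power (e : 'I_p) (x : 'rV[R]_d) : R := x 0 (ri e) ^+ (ci e).*2.+1.

Lemma odd_powerN e x : odd_power e (- x) = - odd_power e x.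
Proof. by rewrite /odd_power mxE exprNn -signr_odd /= odd_double expr1 mulN1r. Qed.

Lemma odd_power_continuous e : continuous (odd_power e).
Proof.
move=> x; apply: (@cvg_comp _ _ _ (fun x : 'rV[R]_d => x 0 (ri e)) (fun z => z ^+ _) _
  (nbhs (x 0 (ri e)))); first exact: coord_continuous.
exact: exprn_continuous.
Qed.

Lemma odd_power_le1 e x : unit_sphere R d x -> `|odd_power e x| <= 1.
Proof.
move=> x1; rewrite /odd_power normrX; apply: exprn_ile1 => //.
exact: unit_sphere_coord.
Qed.

Lemma lincomb_odd_powerN (c : 'rV[R]_p) x :
  lincomb odd_power c (- x) = - lincomb odd_power c x.
Proof.
by rewrite /lincomb -sumrN; apply: eq_bigr => e _; rewrite odd_powerN mulrN.
Qed.

Lemma lincomb_odd_power_continuous (c : 'rV[R]_p) : continuous (lincomb odd_power c).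
Proof.
move=> x; apply: (@cvg_sum_fin _ _ (nbhs x)) => e; apply: cvgM; first exact: cvg_cst.
exact: odd_power_continuous.
Qed.

(** All degrees are odd, so each monomial is raised to degree 2k+1 by a power of cos^2 + sin^2 = 1;
    dividing by the power of sin t turns that factor into a power of cot^2 + 1. *)
Lemma lincomb_odd_power_circle (c : 'rV[R]_p) (a b : 'rV[R]_d) :
  exists2 q : {poly R}, (size q <= k.*2.+2)%N &
    forall t, sin t != 0 -> lincomb odd_power c (cos t *: a + sin t *: b) =
      sin t ^+ k.*2.+1 * q.[cos t / sin t].
Proof.
exists (\sum_e c 0 e *: ((a 0 (ri e) *: 'X + (b 0 (ri e))%:P) ^+ (ci e).*2.+1 *
                         ('X ^+ 2 + 1) ^+ (k - ci e))).
  apply: leq_trans (size_sum _ _ _) _; apply/bigmax_leqP => e _.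
  apply: leq_trans (size_scale_leq _ _) _.
  have -> : k.*2.+2 = (1 * (ci e).*2.+1 + 2 * (k - ci e)).+1 by have := ci_le e; lia.
  apply: size_mul_le_deg; apply: size_exp_le_deg.
    apply: leq_trans (size_polyD _ _) _; rewrite geq_max.
    rewrite (leq_trans (size_scale_leq _ _)) ?size_polyX //=.
    by rewrite (leq_trans (size_polyC_leq1 _)).
  apply: leq_trans (size_polyD _ _) _; by rewrite size_polyXn size_poly1.
move=> t t0; rewrite horner_sum mulr_sumr; apply: eq_bigr => e _.
rewrite /odd_power !mxE hornerZ hornerM !horner_exp !hornerD hornerZ hornerX !hornerC.
rewrite hornerXn mulrCA; congr (_ * _).
set u := a 0 _; set v := b 0 _.
have sc : (cos t / sin t) ^+ 2 + 1 = (sin t ^+ 2)^-1.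
  by rewrite expr_div_n -[X in _ + X](divff (expf_neq0 2 t0)) -mulrDl cos2Dsin2 mul1r.
have -> : cos t * u + sin t * v = sin t * (u * (cos t / sin t) + v) by field.
have -> : k.*2.+1 = ((ci e).*2.+1 + 2 * (k - ci e))%N by have := ci_le e; lia.
rewrite sc exprD exprMn (exprM _ 2) exprVn mulrACA divff ?mulr1 //.
by rewrite !expf_neq0.
Qed.

(* Reflecting the coordinate i' isolates the one-variable odd polynomial
   carried by the coordinate i. *)
Lemma lincomb_odd_power_neq0 (c : 'rV[R]_p) : (1 < d)%N -> c != 0 ->
  (forall e e', ri e = ri e' -> ci e = ci e' -> e = e') ->
  exists2 x, unit_sphere R d x & lincomb odd_power c x != 0.
Proof.
move=> d1 /rV0Pn[e0 ce0] rc_inj; pose i := ri e0.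
have [i' ii'] : exists i' : 'I_d, i' != i.
  have id : ((i == 0 :> nat) < d)%N by apply: leq_ltn_trans (leq_b1 _) d1.
  by exists (Ordinal id); rewrite -val_eqE /=; case: (nat_of_ord i).
pose q := \sum_(e | ri e == i) c 0 e *: 'X ^+ (ci e).*2.+1 : {poly R}.
have q0 : q != 0.
  apply: contra_neq ce0 => q0; have : q`_((ci e0).*2.+1) = 0 by rewrite q0 coef0.
  rewrite coef_sum (bigD1 e0) //= coefZ coefXn eqxx mulr1 big1 ?addr0 // => e /andP[/eqP ee ne].
  rewrite coefZ coefXn; case: eqP => [h|]; last by rewrite mulr0.
  case/eqP: ne; apply: rc_inj => //.
  by apply: double_inj; move: h => [].
(* Among the numbers 1/(j+1) with j below the size of [q], at least one is not a root. *)
have [z [z0 z1] pz] : exists2 z : R, 0 <= z /\ z <= 1 & q.[z] != 0.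
  apply: contrapT => nz.
  pose rs := [seq (j.+1%:R^-1 : R) | j <- iota 0 (size q)].
  have : (size rs < size q)%N.
    apply: max_poly_roots => //.
      apply/allP => u /mapP[j _ ->]; rewrite rootE; apply: contrapT => /negP h.
      apply: nz; exists j.+1%:R^-1 => //; split; first by rewrite invr_ge0 ler0n.
      by rewrite invf_le1 ?ltr0n // ler1n.
    rewrite map_inj_in_uniq ?iota_uniq // => j j' _ _ /invr_inj /eqP.
    by rewrite eqr_nat => /eqP[].
  by rewrite size_map size_iota ltnn.
pose w := Num.sqrt (1 - z ^+ 2).
have w2 : w ^+ 2 = 1 - z ^+ 2.
  by rewrite sqr_sqrtr // subr_ge0 expr_le1.
pose v (s : R) : 'rV[R]_d := \row_j (if j == i then z else if j == i' then s * w else 0).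
have vS (s : R) : s ^+ 2 = 1 -> unit_sphere R d (v s).
  move=> s2; rewrite /unit_sphere /= /dot (bigD1 i) //= (bigD1 i') //=.
  rewrite big1 ?addr0 => [|j /andP[/negPf ji /negPf ji']]; last by rewrite !mxE ji ji' mul0r.
  rewrite !mxE !eqxx (negPf ii') -!expr2 exprMn s2 w2; ring.
have vP : lincomb odd_power c (v 1) + lincomb odd_power c (v (-1)) = 2 * q.[z].
  rewrite /lincomb -big_split /= /q horner_sum mulr_sumr [RHS]big_mkcond /=.
  apply: eq_bigr => e _; rewrite -mulrDr /odd_power !mxE.
  case: eqP => ei; first by rewrite hornerZ hornerXn; ring.
  case: eqP => ei'; last by rewrite expr0n /= addr0 mulr0.
  rewrite mulN1r mul1r exprNn -[(-1) ^+ _]signr_odd /= odd_double expr1 mulN1r subrr.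
  by rewrite mulr0.
have [v1|v1] := eqVneq (lincomb odd_power c (v 1)) 0; last first.
  by exists (v 1) => //; apply: vS; rewrite expr1n.
exists (v (-1)); first by apply: vS; rewrite sqrrN expr1n.
by apply/eqP => vN1; move: vP; rewrite v1 vN1 addr0 => /esym/eqP;
  rewrite mulf_eq0 (negPf pz) pnatr_eq0.
Qed.

Lemma maximizers_dist (c : 'rV[R]_p) x y :
  (forall z, unit_sphere R d z -> lincomb odd_power c z <= lincomb odd_power c x) ->
  0 < lincomb odd_power c x ->
  lincomb odd_power c y = lincomb odd_power c x ->
  unit_sphere R d x -> unit_sphere R d y ->
  sphere_dist x y <= pi - pi / k.*2.+1%:R.
Proof.
move=> maxx M0 Pyx x1 y1; set M := lincomb _ _ x in maxx M0 Pyx.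
have xy := unit_sphere_dot x1 y1; rewrite /sphere_dist.
set al := acos _; pose b := pi - al.
have [al0 al1] : 0 <= al /\ al <= pi by split; [exact: acos_ge0|exact: acos_lepi].
have cb : cos b = - dot x y.
  by rewrite /b addrC cosDpi cosN /al acosK // in_itv.
have P_le z : unit_sphere R d z -> `|lincomb odd_power c z| <= M.
  move=> z1; rewrite ler_norml maxx // andbT lerNl -lincomb_odd_powerN.
  exact/maxx/unit_sphereN.
(* Here [b] is the distance from x to -y. *)
suff : pi / k.*2.+1%:R <= b by rewrite /b !lerBrDr addrC.
have b0 : 0 < b.
  rewrite lt_neqAle subr_ge0 al1 andbT; apply/eqP => b0.
  move: cb; rewrite -b0 cos0 => xyN1.
  have xy0 : x + y = 0.
    by apply: dot_eq0; rewrite dotDl !dotDr (dotC y x) x1 y1; lra.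
  have yx : y = - x by rewrite -[y](addKr x) xy0 addr0.
  by move: Pyx; rewrite yx lincomb_odd_powerN -/M; lra.
(* If b = pi, no great circle is singled out, but the bound is immediate. *)
have [bp|pb] := ltP b pi; last first.
  by apply: le_trans pb; rewrite ler_pdivrMr ?ltr0n // ler_peMr ?pi_ge0 // ler1n.
have sb : 0 < sin b by rewrite sin_gt0_pi // b0.
(* The unit tangent at x pointing to -y, so that the circle [g] reaches -y at time b. *)
pose e := (sin b)^-1 *: (- y - cos b *: x).
have xe : dot x e = 0 by rewrite /e dotZr dotDr !dotNr dotZr x1 cb; ring.
have e1 : unit_sphere R d e.
  rewrite /unit_sphere /= /e dotZl dotZr dotDl !dotDr !(dotNl, dotNr, dotZl, dotZr).
  have xyc : dot x y = - cos b by rewrite cb opprK.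
  rewrite (dotC y x) x1 y1 xyc mulrA -invfM -expr2.
  rewrite -[RHS](mulVf (lt0r_neq0 (exprn_gt0 2 sb))); congr (_ * _).
  have -> : sin b ^+ 2 = 1 - cos b ^+ 2 by rewrite -(cos2Dsin2 b) addrAC subrr add0r.
  ring.
pose g t := lincomb odd_power c (cos t *: x + sin t *: e).
apply: (@riesz_max_min R k.*2.+1 g M b) => //.
- move=> t; apply: (@cvg_comp _ _ _ (fun t => cos t *: x + sin t *: e)
    (lincomb odd_power c) _ (nbhs (cos t *: x + sin t *: e))).
    apply: cvgD; apply: cvgZr_tmp; [exact: continuous_cos|exact: continuous_sin].
  exact: lincomb_odd_power_continuous.
- by move=> t; apply: P_le; exact: great_circle.
(* A translation of the parameter is a rotation of the orthonormal pair spanning the plane. *)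
- move=> s; have [q sq qP] := lincomb_odd_power_circle c
    (cos s *: x - sin s *: e) (sin s *: x + cos s *: e).
  exists q => // t /qP <-; rewrite /g cosB sinB; congr lincomb.
  by apply/rowP => j; rewrite !mxE; ring.
- by rewrite /g cos0 sin0 scale1r scale0r addr0.
- rewrite /g /e scalerA divff ?lt0r_neq0 // scale1r addrC subrK.
  by rewrite lincomb_odd_powerN Pyx.
Qed.

End OddPowers.

(** * The extremal set and its diameter *)

Lemma small_diameter_hull (R : realType) (d l k : nat)
    (f : 'rV[R]_d -> 'rV[R]_l) :
  (1 < d)%N -> (l < d * k.+1)%N -> odd_on_sphere f ->
  {within unit_sphere R d, continuous f} ->
  exists X : set 'rV[R]_d,
    [/\ X `<=` unit_sphere R d,
        (sphere_diam X <= (pi - pi / k.*2.+1%:R)%:E)%E & conv_hull (f @` X) 0].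
Proof.
move=> d1 ld f_odd f_cont; have d0 := ltnW d1.
(* Division of e by d with remainder lists l+1 distinct monomials: the remainder selects the
   coordinate and the quotient, at most k, the exponent. *)
pose ri (e : 'I_l.+1) : 'I_d := Ordinal (ltn_pmod e d0).
pose ci (e : 'I_l.+1) : nat := (e %/ d)%N.
have ci_le e : (ci e <= k)%N.
  by rewrite -ltnS /ci ltn_divLR // mulnC; apply: leq_trans ld; exact: ltn_ord.
have rc_inj e e' : ri e = ri e' -> ci e = ci e' -> e = e'.
  move=> /(congr1 val) /= rr cc; apply/val_inj.
  by rewrite /= (divn_eq e d) (divn_eq e' d) rr; congr (_ * _ + _)%N.
pose phi := @odd_power R d _ ri ci.
have S0 : unit_sphere R d !=set0.
  have /(lincomb_odd_power_neq0 d1)/(_ rc_inj)[x x1 _] : const_mx 1 != 0 :> 'rV[R]_l.+1.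
    by apply/eqP => /rowP/(_ 0)/eqP; rewrite !mxE oner_eq0.
  by exists x.
have [c c1 hull0] := extremal_hull (unit_sphere_compact (d := d)) S0
  (@unit_sphereN R d) (odd_power_continuous (ri := ri) (ci := ci))
  (fun e y _ => odd_powerN ri ci e y) (@odd_power_le1 R d _ ri ci) f_odd f_cont.
have c0 : c != 0.
  apply: contra_eq_neq c1 => ->; rewrite /norm1 big1 1?eq_sym ?oner_eq0 // => e _.
  by rewrite mxE normr0.
pose P := lincomb phi c.
(* P is odd and not identically zero on the sphere, so its maximum is positive. *)
have [z z1 Pz] : exists2 z, unit_sphere R d z & 0 < P z.
  have [z z1 Pz] := lincomb_odd_power_neq0 d1 c0 rc_inj.
  case: (ltgtP 0 (P z)) => [Pz0|Pz0|Pz0]; first by exists z.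
    by exists (- z); [exact: unit_sphereN|rewrite /P lincomb_odd_powerN oppr_gt0].
  by move: Pz; rewrite -/phi -/(P z) -Pz0 eqxx.
exists [set x | unit_sphere R d x /\ forall y, unit_sphere R d y -> P y <= P x].
split => //; first by move=> x [].
apply: ge_ereal_sup => _ [[x y] [[x1 maxx] [y1 maxy]] <-]; rewrite lee_fin.
apply: (maximizers_dist ci_le maxx) => //; first exact: lt_le_trans Pz (maxx z z1).
by apply/eqP; rewrite eq_le maxx // maxy.
Qed.

Theorem theorem2 (R : realType) (n k : nat) (hn : (1 <= n)%N)
    (f : 'rV[R]_(2 * n) -> 'rV[R]_(2 * k * n + 2 * n - 1))
    (f_odd : odd_on_sphere f)
    (f_cont : {within unit_sphere R (2 * n), continuous f}) :
  exists X : set 'rV[R]_(2 * n),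
    [/\ X `<=` unit_sphere R (2 * n),
        (sphere_diam X <= (2 * pi * k%:R / (2 * k%:R + 1))%:E)%E &
        conv_hull (f @` X) 0].
Proof.
have d1 : (1 < 2 * n)%N by lia.
(* The target dimension is one less than the number 2n(k+1) of monomials. *)
have ld : (2 * k * n + 2 * n - 1 < 2 * n * k.+1)%N by nia.
have [X [XS Xdiam X0]] := small_diameter_hull d1 ld f_odd f_cont.
exists X; split => //.
suff <- : pi - pi / k.*2.+1%:R = 2 * pi * k%:R / (2 * k%:R + 1) :> R by [].
have k0 : 2 * k%:R + 1 != 0 :> R by rewrite lt0r_neq0 // ltr_wpDl // mulr_ge0.
by rewrite -natr1 -mul2n natrM; field.
Qed.
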